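(* The closure of the set of all zeros in $\mathbb{C}$ of all the polynomials $M_n(x)$, $n\ge 0$, has a positive distance to $[0,\infty)$.
   Context: Sierpinski gasket graphs: $\mathcal{G}_0$ is a triangle (three vertices, three edges), whose three vertices are its external corners. For $n\ge 1$, $\mathcal{G}_n$ is obtained from three copies of $\mathcal{G}_{n-1}$ by joining them at their external corners: for each pair of copies, one external corner of one copy is identified with one external corner of the other, the three identifications using six distinct corners; the three remaining unidentified corners are the external corners of $\mathcal{G}_n$. Let $Z_n(y)=\sum_{\sigma}y^{\sum_{\langle v,w\rangle}\sigma(v)\sigma(w)}$ be the Ising partition function of $\mathcal{G}_n$, the outer sum being over all maps $\sigma$ from the vertices of $\mathcal{G}_n$ to $\{\pm1\}$ and the inner sum over the edges of $\mathcal{G}_n$, each counted once. The polynomial $M_n\in\mathbb{Z}[x]$ is defined by $M_n(y^4)=\frac{y^{3^n}Z_n(y)}{2}$. It satisfies $M_0(x)=x+3$ and, for $n\ge1$, $M_n(x)=M_{n-1}(f(x))[(x+1)(x+3)]^{3^{n-1}}$ with $f(x)=\frac{x^2-x+4}{x+3}$. *)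

(* Defs.v *)
From HB Require Import structures.
From mathcomp Require Import all_boot all_order all_algebra.
From mathcomp Require Import complex.
From mathcomp Require Import mathcomp_extra boolp classical_sets functions.
From mathcomp Require Import reals ereal topology normedtype.
From mathcomp Require Import zify.

Set Implicit Arguments.
Unset Strict Implicit.
Unset Printing Implicit Defensive.

Import Order.TTheory GRing.Theory Num.Theory.
Import numFieldNormedType.Exports.

Local Open Scope ring_scope.
Local Open Scope complex_scope.

(* The vertices of the gasket graph G_n are its three external corners,
   numbered by 'I_3, and its other vertices. In G_(n+1) the latter are: for each
   copy i of G_n, the vertices of that copy that are not external corners of
   the copy; and three junctions, the k-th being the vertex shared by the two
   copies i, j with {i, j, k} = {0, 1, 2}. *)
Fixpoint inner (n : nat) : finType :=
  if n is m.+1 then (('I_3 * inner m) + 'I_3)%type : finType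
  else void : finType.

Definition vertex (n : nat) : finType := ('I_3 + inner n)%type : finType.

Definition corner (n : nat) (j : 'I_3) : vertex n := inl j.

(* For i <> j, the index other than i and j: indices add in Z/3, and
   0 + 1 + 2 = 0 there. *)
Definition third (i j : 'I_3) : 'I_3 := - (i + j).

(* The vertex of G_(n+1) at which vertex v of the i-th copy of G_n ends up.
   Corner i of copy i becomes external corner i; for i <> j, corner j of copy i
   and corner i of copy j are identified, to junction third i j. *)
Definition embed (n : nat) (i : 'I_3) (v : vertex n) : vertex n.+1 :=
  match v with
  | inl j => if i == j then inl i else inr (inr (third i j))
  | inr x => inr (inl (i, x))
  end.

(* Edges as two-element sets of vertices. *)
Fixpoint edges (n : nat) : {set {set vertex n}} :=
  match n with
  | 0 => [set e : {set vertex 0} | #|e| == 2]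
  | m.+1 => \bigcup_(i : 'I_3) [set embed i @: (e : {set vertex m}) | e in edges m]
  end.

Definition spin (b : bool) : int := if b then 1 else -1.

(* For an edge e = {v, w} the product over e is sigma(v) sigma(w). *)
Definition energy (n : nat) (s : {ffun vertex n -> bool}) : int :=
  \sum_(e in edges n) \prod_(v in e) spin (s v).

Definition isingZ (F : fieldType) (n : nat) (y : F) : F :=
  \sum_(s : {ffun vertex n -> bool}) y ^ energy s.

(* p(y^4) = y^(3^n) Z_n(y) / 2 as an identity in y; negative powers of y occur
   in Z_n, so y = 0 is left out. *)
Definition is_isingM (n : nat) (p : {poly int}) : Prop :=
  forall (F : numFieldType) (y : F), y != 0 ->
    (map_poly intr p).[y ^+ 4] = y ^+ (3 ^ n) * isingZ n y / 2.

Lemma ord3P (P : 'I_3 -> Prop) :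
  P (@Ordinal 3 0 isT) -> P (@Ordinal 3 1 isT) -> P (@Ordinal 3 2 isT) ->
  forall i, P i.
Proof.
by move=> P0 P1 P2 [[|[|[|//]]] lt]; rewrite (bool_irrelevance lt isT).
Qed.

Lemma third_inj (i j j' : 'I_3) : third i j = third i j' -> j = j'.
Proof.
move: j'; elim/ord3P: j; elim/ord3P; elim/ord3P: i => // /(congr1 val)//.
Qed.

Lemma third_eq (i j i' j' : 'I_3) :
  i != i' -> i != j -> i' != j' -> third i j = third i' j' -> j = i'.
Proof.
by elim/ord3P: i; elim/ord3P: i'; elim/ord3P: j; elim/ord3P: j' =>
  // _ _ _ /(congr1 val).
Qed.

Lemma embed_inj n i : injective (@embed n i).
Proof.
move=> [j|x] [j'|x'] //=; last by case=> ->.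
- case: eqP => [<-|ij]; case: eqP => [<-|ij'] //.
  by move=> H; rewrite (third_inj (inr_inj (inr_inj H))).
- by case: eqP.
- by case: eqP.
Qed.

Lemma embed_common n (i i' : 'I_3) (v v' : vertex n) :
  i != i' -> embed i v = embed i' v' -> v = corner n i'.
Proof.
move=> ne; case: v => [j|x]; case: v' => [j'|x'] //=.
- case: eqP => [_|ij]; case: eqP => [_|ij'] //.
    by move=> [E]; rewrite E eqxx in ne.
  by move=> H; rewrite (third_eq ne _ _ (inr_inj (inr_inj H))) //; apply/eqP.
- by case: eqP.
- by case: eqP.
- by case=> E; rewrite E eqxx in ne.
Qed.

Lemma card_edge n (e : {set vertex n}) : e \in edges n -> #|e| = 2.
Proof.
elim: n e => [|n IH] e /=; first by rewrite inE => /eqP.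
case/bigcupP=> i _ /imsetP[e' /IH he ->].
by rewrite card_imset //; apply: embed_inj.
Qed.

Lemma edge_sum (n : nat) (V : nmodType) (F : {set vertex n.+1} -> V) :
  \sum_(e in edges n.+1) F e =
  \sum_(i : 'I_3) \sum_(e in edges n) F (embed i @: e).
Proof.
rewrite /= partition_disjoint_bigcup /=; last first.
  move=> i j ij; rewrite -setI_eq0; apply/eqP/setP=> e; rewrite !inE.
  apply/negbTE/negP=> /andP[/imsetP[a ha ->] /imsetP[b hb E]].
  have: a \subset [set corner n j].
    apply/fintype.subsetP=> v va; rewrite inE; apply/eqP.
    have: embed i v \in embed i @: a by apply: imset_f.
    by rewrite E => /imsetP[w wb /(embed_common ij)].
  by move/subset_leq_card; rewrite cards1 (card_edge ha).
apply: eq_bigr => i _; rewrite big_imset //=.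
by move=> a b _ _; apply: imset_inj; apply: embed_inj.
Qed.

Lemma energyS n (s : {ffun vertex n.+1 -> bool}) :
  energy s = \sum_(i : 'I_3) energy [ffun v => s (embed i v)].
Proof.
rewrite /energy edge_sum; apply: eq_bigr => i _; apply: eq_bigr => e _.
rewrite big_imset; last by move=> a b _ _; apply: embed_inj.
by apply: eq_bigr => v _; rewrite ffunE.
Qed.

Lemma energy0 (s : {ffun vertex 0 -> bool}) :
  energy s = (\prod_v spin (s v)) * \sum_(j : 'I_3) spin (s (corner 0 j)).
Proof.
have c3 : #|vertex 0| = 3 by rewrite card_sum card_ord card_void.
have -> : energy s = \sum_(e in [set ~: [set corner 0 j] | j : 'I_3])
                       \prod_(v in e) spin (s v).
  apply: eq_bigl => e; rewrite inE; apply/eqP/imsetP.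
    move=> e2; have : #|~: e| == 1%N by have := cardsC e; rewrite e2 c3; lia.
    by case/cards1P=> -[j|//] /(congr1 (@finset.setC _)); rewrite finset.setCK; exists j.
  by case=> j _ ->; have := cardsC1 (corner 0 j); rewrite c3.
rewrite big_imset /=; last first.
  by move=> i j _ _ /finset.setC_inj/finset.set1_inj[].
rewrite mulr_sumr; apply: eq_big => [i|j _]; first by rewrite inE.
rewrite [in RHS](bigD1 (corner 0 j)) //= mulrC mulrA.
have -> : spin (s (corner 0 j)) * spin (s (corner 0 j)) = 1 by case: (s _).
by rewrite mul1r; apply: eq_bigl => v; rewrite !inE.
Qed.

Lemma energy_mod n (s : {ffun vertex n -> bool}) :
  exists k : nat, (3 ^ n)%:Z + energy s = (4 * k)%:Z.
Proof.
elim: n s => [|n IH] s.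
  rewrite energy0 big_sumType /= [X in _ * X * _]big_pred0 => [|[]//].
  rewrite !big_ord_recl !big_ord0 /corner.
  by do 3 case: (s _); [exists 1%N|exists 0%N|exists 0%N|exists 0%N
    |exists 0%N|exists 0%N|exists 0%N|exists 1%N].
have [k kP] := choice IH.
exists (\sum_(i : 'I_3) k [ffun v => s (embed i v)])%N.
rewrite energyS !big_ord_recl !big_ord0.
have := kP [ffun v => s (embed ord0 v)].
have := kP [ffun v => s (embed (lift ord0 ord0) v)].
have := kP [ffun v => s (embed (lift ord0 (lift ord0 ord0)) v)].
rewrite expnS; lia.
Qed.

Definition flip n (s : {ffun vertex n -> bool}) := [ffun v => ~~ s v].

Lemma energy_flip n (s : {ffun vertex n -> bool}) : energy (flip s) = energy s.
Proof.
apply: eq_bigr => e he; rewrite (eq_bigr (fun v => -1 * spin (s v))).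
  by rewrite big_split /= prodr_const (card_edge he) mul1r.
by move=> v _; rewrite ffunE; case: (s v).
Qed.

Lemma isingZ_half (F : fieldType) n (y : F) :
  isingZ n y = (\sum_(s : {ffun vertex n -> bool} | s (corner n 0)) y ^ energy s) *+ 2.
Proof.
rewrite /isingZ (bigID (fun s : {ffun vertex n -> bool} => s (corner n 0))) /=.
rewrite mulr2n; congr (_ + _).
have flipK : involutive (@flip n) by move=> s; apply/ffunP=> v; rewrite !ffunE negbK.
rewrite (reindex_inj (inv_inj flipK)) /=.
by apply: eq_big => [s|s _]; rewrite ?energy_flip // ffunE negbK.
Qed.

Lemma isingM_exists n : exists p, is_isingM n p.
Proof.
have [k kP] := choice (@energy_mod n).
exists (\sum_(s : {ffun vertex n -> bool} | s (corner n 0)) 'X^(k s)).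
move=> F y y0; rewrite isingZ_half -[_ *+ 2]mulr_natr mulrA mulfK ?pnatr_eq0 //.
rewrite rmorph_sum horner_sum mulr_sumr; apply: eq_bigr => s _ /=.
rewrite map_polyXn hornerXn -exprM !exprnP -expfzDr //.
by rewrite kP.
Qed.

Definition isingM (n : nat) : {poly int} := projT1 (cid (isingM_exists n)).

Lemma isingMP n : is_isingM n (isingM n).
Proof. exact: projT2 (cid (isingM_exists n)). Qed.

(* (R[i])^o is the complex plane R[i] with the topology given by the modulus. *)
Definition isingM_zeros (R : realType) : set (R[i])^o :=
  [set z | exists n, root (map_poly intr (isingM n) : {poly R[i]}) z]%classic.
Arguments isingM_zeros R : clear implicits.

Definition nonneg_axis (R : realType) : set (R[i])^o :=
  [set t%:C | t in [set t : R | 0 <= t]]%classic.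
Arguments nonneg_axis R : clear implicits.

(* The norm on R[i] has values in R[i], whence the real part. *)
Definition set_dist (R : realType) (A B : set (R[i])^o) : \bar R :=
  ereal_inf [set (complex.Re `|(a - b : R[i])|)%:E | a in A & b in B]%classic.

(* Main.v *)
(** Let p and q be the sums of y^energy over the configurations of G_n whose
    external corners carry equal, respectively not all equal, spins. Summing
    over the spins of the three junctions gives a recursion for (p, q) under
    which r = p / q, initially y^4, evolves by r |-> f(r), while
    Z_n / 2 = q (r + 3). In terms of w = r - 1, the map f is
    w |-> w^2 / (w + 4), and the union D of the disk |w| < 2 with the half-strip
    Re w >= 0, |Im w| < 1 is mapped into itself. As D contains the points at
    distance less than 1 from [0, oo) but neither -1 nor -3, no M_n vanishes
    on D; so the distance is at least 1. *)
Require Import Defs.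
From mathcomp Require Import all_boot all_order all_algebra.
From mathcomp Require Import complex.
From mathcomp Require Import boolp classical_sets reals ereal topology normedtype.
From mathcomp Require Import ring lra.
Import Order.TTheory GRing.Theory Num.Theory.
Import numFieldNormedType.Exports.

Local Open Scope ring_scope.
Local Open Scope complex_scope.

(** * Partition sums with fixed corner spins *)

Definition inner_sum (F : fieldType) (y : F) n (a : {ffun 'I_3 -> bool}) : F :=
  \sum_(s : {ffun inner n -> bool})
    y ^ energy [ffun v => match v with inl j => a j | inr x => s x end].

(* The corner spins of copy i, given those of G_(n+1) and of its junctions. *)
Definition copy_corners (a j : {ffun 'I_3 -> bool}) (i : 'I_3) :
    {ffun 'I_3 -> bool} :=
  [ffun k => if i == k then a i else j (third i k)].

Lemma big_ffun_sum (V : nmodType) (A B T : finType) (G : {ffun A + B -> T} -> V) :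
  \sum_(s : {ffun A + B -> T}) G s =
  \sum_(s : {ffun A -> T}) \sum_(t : {ffun B -> T})
    G [ffun v => match v with inl a => s a | inr b => t b end].
Proof.
pose glue (p : {ffun A -> T} * {ffun B -> T}) : {ffun A + B -> T} :=
  [ffun v => match v with inl a => p.1 a | inr b => p.2 b end].
rewrite pair_big /= (reindex glue) //=.
exists (fun s : {ffun A + B -> T} => ([ffun a => s (inl a)], [ffun b => s (inr b)])).
  by case=> s t _; congr pair; apply/ffunP => v; rewrite !ffunE.
by move=> s _; apply/ffunP => -[v|v]; rewrite !ffunE.
Qed.

Lemma big_ffun_curry (V : nmodType) (A B T : finType) (G : {ffun A * B -> T} -> V) :
  \sum_(s : {ffun A * B -> T}) G s =
  \sum_(s : {ffun A -> {ffun B -> T}}) G [ffun v => s v.1 v.2].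
Proof.
rewrite (reindex (fun s : {ffun A -> {ffun B -> T}} => [ffun v => s v.1 v.2])) //=.
exists (fun s : {ffun A * B -> T} => [ffun a => [ffun b => s (a, b)]]).
  by move=> s _; apply/ffunP => a; apply/ffunP => b; rewrite !ffunE.
by move=> s _; apply/ffunP => -[a b]; rewrite !ffunE.
Qed.

Lemma isingZ_inner_sum (F : fieldType) (y : F) n :
  isingZ n y = \sum_(a : {ffun 'I_3 -> bool}) inner_sum F y n a.
Proof. exact: big_ffun_sum. Qed.

(** Once the corner and junction spins are fixed, the three copies share no free spin, so the sum
    factors over them. *)
Lemma inner_sumS (F : fieldType) (y : F) n a : y != 0 ->
  inner_sum F y n.+1 a =
  \sum_(j : {ffun 'I_3 -> bool}) \prod_i inner_sum F y n (copy_corners a j i).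
Proof.
move=> y0; rewrite /inner_sum big_ffun_sum exchange_big /=.
apply: eq_bigr => j _; rewrite bigA_distr_bigA big_ffun_curry /=.
apply: eq_bigr => s _.
rewrite energyS (big_morph (fun k : int => y ^ k) (fun k l => expfzDr k l y0)
  (expr0z y)).
apply: eq_bigr => i _; congr (_ ^ energy _).
by apply/ffunP => -[k|x]; rewrite !ffunE /=; try case: (i =P k) => _; rewrite ?ffunE.
Qed.

Definition triple (p q r : bool) : {ffun 'I_3 -> bool} :=
  [ffun k : 'I_3 => nth true [:: p; q; r] k].

Lemma big_ffun3 (V : nmodType) (G : {ffun 'I_3 -> bool} -> V) :
  \sum_a G a = \sum_(p : bool) \sum_(q : bool) \sum_(r : bool) G (triple p q r).
Proof.
rewrite pair_big /= pair_big /=.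
rewrite (reindex (fun b : bool * bool * bool => triple b.1.1 b.1.2 b.2)) //=.
pose o k (lt : (k < 3)%N) : 'I_3 := Ordinal lt.
exists (fun a : {ffun 'I_3 -> bool} => (a (o 0 isT), a (o 1 isT), a (o 2 isT))).
  by case=> -[p q] r _; rewrite !ffunE.
by move=> a _; apply/ffunP; apply: ord3P; rewrite ffunE.
Qed.

Lemma prod_copy_corners (F : comPzRingType) (G : {ffun 'I_3 -> bool} -> F) p q r u v w :
  \prod_i G (copy_corners (triple p q r) (triple u v w) i) =
  G (triple p w v) * G (triple w q u) * G (triple v u r).
Proof.
rewrite !big_ord_recl big_ord0 mulr1 mulrA.
by do !congr (_ * _); congr (G _); apply/ffunP; apply: ord3P; rewrite !ffunE.
Qed.

(* (p, q) of the header, multiplied by y^(3^n) to make them polynomials in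
   x = y^4. *)
Fixpoint corner_weights (F : pzRingType) (x : F) n : F * F :=
  if n is m.+1 then let: (p, q) := corner_weights F x m in
    (p ^+ 3 + 3 * p * q ^+ 2 + 4 * q ^+ 3, q * (p + q) * (p + 3 * q))
  else (x, 1).

(** By induction each copy only sees whether its corner spins agree; the eight junction
    configurations then add up to the recursion of [corner_weights]. *)
Lemma inner_sum_corner_weights (F : fieldType) (y : F) n p q r : y != 0 ->
  y ^+ (3 ^ n) * inner_sum F y n (triple p q r) =
  if (p == q) && (q == r) then (corner_weights F (y ^+ 4) n).1
  else (corner_weights F (y ^+ 4) n).2.
Proof.
move=> y0; elim: n p q r => [|n IH] p q r.
  rewrite /inner_sum /= (big_pred1 [ffun x : void => true]); last first.
    by move=> s; apply/esym/eqP/ffunP => -[].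
  rewrite energy0 big_sumType /= [X in _ * X * _]big_pred0 => [|[]//].
  rewrite !big_ord_recl !big_ord0 !ffunE /=.
  by case: p; case: q; case: r;
    rewrite //= ?exprN1 ?mulfV // -exprnP -exprS.
rewrite inner_sumS // mulr_sumr big_ffun3 !big_bool !prod_copy_corners /= expnSr exprM.
have {}IH u v w := canRL (mulKf (expf_neq0 _ y0)) (IH u v w).
rewrite !IH /=; case: (corner_weights F (y ^+ 4) n) => A B.
by case: p; case: q; case: r => /=; field; rewrite expf_neq0.
Qed.

(** * Passage to the polynomials M_n *)

Lemma poly_eq0_horner (F : numFieldType) (p : {poly F}) :
  (forall x, p.[x] = 0) -> p = 0.
Proof.
move=> p0; apply/eqP/negPn/negP => pn0.
(* In characteristic 0 the naturals below [size p] are distinct, which is one root too many. *)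
have /= := max_poly_roots pn0 (rs := [seq k%:R | k <- iota 0 (size p)]).
rewrite size_map size_iota ltnn => H; suff: false by [].
apply: H.
  by apply/allP => x _; rewrite rootE p0.
by rewrite map_inj_uniq ?iota_uniq //; apply: mulrIn; rewrite oner_eq0.
Qed.

Lemma corner_weights_horner (F : fieldType) (x : F) n :
  let: (p, q) := corner_weights {poly F} 'X n in
  corner_weights F x n = (p.[x], q.[x]).
Proof.
elim: n => [|n] /=; first by rewrite hornerX hornerC.
case: (corner_weights {poly F} 'X n) => p q ->.
by rewrite !(hornerD, hornerM, horner_exp, hornerMn, hornerC).
Qed.

(** Two of the eight corner assignments are constant and six are not; half of 2p + 6q remains. *)
Lemma isingM_corner_weights (F : numClosedFieldType) n (x : F) :
  (map_poly intr (isingM n)).[x] =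
  (corner_weights F x n).1 + 3 * (corner_weights F x n).2.
Proof.
(* At z = 0 there is no admissible y, so that value comes from the identity of
   polynomials. *)
have nz z : z != 0 -> (map_poly intr (isingM n)).[z] =
    (corner_weights F z n).1 + 3 * (corner_weights F z n).2.
  move=> z0; have zE : z = 4.-root z ^+ 4 by rewrite rootCK.
  have y0 : 4.-root z != 0 by rewrite rootC_eq0.
  rewrite {1}zE isingMP // isingZ_inner_sum mulr_sumr big_ffun3.
  rewrite !big_bool !inner_sum_corner_weights //= -zE.
  by field.
have := corner_weights_horner F x n; move: (fun z => corner_weights_horner F z n).
case: (corner_weights {poly F} 'X n) => p q gE -> /=.
(* The factor ['X] makes the identity hold at 0 as well; it is cancelled afterwards. *)
have : (map_poly intr (isingM n) - (p + 3%:P * q)) * 'X = 0 :> {poly F}.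
  apply: poly_eq0_horner => z; rewrite !hornerE.
  have [->|z0] := eqVneq z 0; first by rewrite mulr0.
  by rewrite nz // gE /= subrr mul0r.
move/eqP; rewrite mulf_eq0 polyX_eq0 orbF subr_eq0 => /eqP ->.
by rewrite !hornerE.
Qed.

(** * The invariant region D and its dynamics *)

Definition stable (R : realType) (z : R[i]) : Prop :=
  (complex.Re z - 1) ^+ 2 + complex.Im z ^+ 2 < 4
  \/ 0 <= complex.Re z - 1 /\ complex.Im z ^+ 2 < 1.

(** Real part at least 1 leads to the half-strip, a smaller one to the disk: for a negative real
    part, z lies in the unit disk about 0, hence within 2 of 1. *)
Lemma stable_nbr (R : realType) (z : R[i]) (t : R) :
  0 <= t -> `|z - t%:C| < 1 -> stable R z.
Proof.
case: z => a b t0 H.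
have {H} : (a - t) ^+ 2 + b ^+ 2 < 1.
  have : (((a - t) ^+ 2 + b ^+ 2)%:C < 1).
    have := add_Re2_Im2 ((a +i* b) - t%:C); rewrite /= subr0 => ->.
    by rewrite expr_lt1 ?normr_ge0.
  by rewrite ltcR.
rewrite /stable /=; case: (leP 1 a) => a1 H; last first.
  left; have [a0|a0] := leP 0 a; first by nra.
  have a2 : a ^+ 2 <= (a - t) ^+ 2 by nra.
  have : -1 < a by have := sqr_ge0 b; nra.
  nra.
by right; rewrite subr_ge0; split=> //; have := sqr_ge0 (a - t); lra.
Qed.

(** In terms of w = z - 1 the excluded points are -2, on the boundary of the open disk, and -4. *)
Lemma stable_neq (R : realType) (z : R[i]) : stable R z -> z + 1 != 0 /\ z + 3 != 0.
Proof.
case: z => a b H; split; apply/eqP => /(congr1 (fun z => (complex.Re z, complex.Im z))) /=.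
all: by case=> E1 E2; case: H => /= H; nra.
Qed.

(* Real and imaginary parts of w (z + 4) = z^2 with z = A + bi, w = C + di. *)
Lemma stable_square_step (R : realFieldType) (A b C d : R) :
  A ^+ 2 + b ^+ 2 < 4 \/ 0 <= A /\ b ^+ 2 < 1 ->
  C * (A + 4) - d * b = A ^+ 2 - b ^+ 2 ->
  C * b + d * (A + 4) = 2 * A * b ->
  C ^+ 2 + d ^+ 2 < 4 \/ 0 <= C /\ d ^+ 2 < 1.
Proof.
move=> H E1 E2.
pose m := (A + 4) ^+ 2 + b ^+ 2.
have nE : (C ^+ 2 + d ^+ 2) * m = (A ^+ 2 + b ^+ 2) ^+ 2.
  have -> : (C ^+ 2 + d ^+ 2) * m =
    (C * (A + 4) - d * b) ^+ 2 + (C * b + d * (A + 4)) ^+ 2 by rewrite /m; ring.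
  by rewrite E1 E2; ring.
case: H => [H|[A0 b1]].
  (* Here |z + 4| > 2, so |w| = |z|^2 / |z + 4| < 2. *)
  left.
  have m4 : 4 < m by rewrite /m; nra.
  rewrite ltNge; apply/negP => H4.
  have : 4 * 4 <= (A ^+ 2 + b ^+ 2) ^+ 2 by rewrite -nE ler_pM // ltW.
  rewrite expr2; nra.
have m16 : 16 <= m by rewrite /m; nra.
have m0 : 0 < m by lra.
have CE : C * m = A ^+ 3 + 4 * A ^+ 2 + A * b ^+ 2 - 4 * b ^+ 2.
  have -> : C * m = (C * (A + 4) - d * b) * (A + 4) + (C * b + d * (A + 4)) * b
    by rewrite /m; ring.
  by rewrite E1 E2; ring.
have dE : d * m = b * (A ^+ 2 + 8 * A + b ^+ 2).
  have -> : d * m = - (C * (A + 4) - d * b) * b + (C * b + d * (A + 4)) * (A + 4)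
    by rewrite /m; ring.
  by rewrite E1 E2; ring.
(* The bracket in [dE] is [m - 16], so |d| = |b| (m - 16) / m < 1. *)
have d1 : d ^+ 2 < 1.
  rewrite -(ltr_pM2r (exprn_gt0 2 m0)) mul1r -exprMn dE exprMn.
  apply: (@le_lt_trans _ _ ((A ^+ 2 + 8 * A + b ^+ 2) ^+ 2)).
    by rewrite ler_piMl ?sqr_ge0 // ltW.
  by rewrite ltrXn2r // ?nnegrE /m; nra.
have [C0|C0] := leP 0 C; first by right.
(* By [CE], C m >= -4 b^2 > -4 > -m, so a negative [C] exceeds -1 and |w|^2 < 2. *)
left; suff : C ^+ 2 < 1 by lra.
have : -1 < C.
  rewrite -(ltr_pM2r m0) CE.
  have : 0 <= A ^+ 3 by rewrite exprn_ge0.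
  have : 0 <= A * b ^+ 2 by rewrite mulr_ge0 ?sqr_ge0.
  have := sqr_ge0 A; lra.
by move=> C1; nra.
Qed.

(** The equation is w = f(z) with its denominator cleared, since f(z) - 1 = (z - 1)^2 / (z + 3). *)
Lemma stable_step (R : realType) (z w : R[i]) : stable R z ->
  (w - 1) * (z + 3) = (z - 1) ^+ 2 -> stable R w.
Proof.
case: z w => [a b] [c d] H.
rewrite expr2 => /(congr1 (fun z => (complex.Re z, complex.Im z))) /= [E1 E2].
by apply: (stable_square_step _ _ _ _ _ H) => /=; [move: E1 | move: E2] => E; lra.
Qed.

(** With r = p / q the next q is q^3 (r + 1) (r + 3), nonzero because r lies in D. *)
Lemma corner_weights_stable (R : realType) (z : R[i]) n : stable R z ->
  let: (p, q) := corner_weights R[i] z n in q != 0 /\ stable R (p / q).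
Proof.
move=> Dz; elim: n => [|n] /=; first by rewrite oner_eq0 divr1.
case: (corner_weights _ _ n) => p q [q0 Dr].
have [r1 r3] := stable_neq _ _ Dr.
have pE : p = p / q * q by rewrite divfK.
move: (p / q) pE r1 r3 Dr => r -> r1 r3 Dr.
have -> : r * q + q = (r + 1) * q by ring.
have -> : r * q + 3 * q = (r + 3) * q by ring.
split; first by rewrite !mulf_neq0.
by apply: stable_step Dr _; field; rewrite q0 r1 r3.
Qed.

Lemma isingM_stable (R : realType) (z : R[i]) n : stable R z ->
  ~~ root (map_poly intr (isingM n)) z.
Proof.
move=> Dz; rewrite rootE isingM_corner_weights.
have := corner_weights_stable R z n Dz; case: (corner_weights _ _ _) => p q /= [q0 Dr].
have [_ r3] := stable_neq _ _ Dr.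
have -> : p + 3 * q = (p / q + 3) * q by field.
by rewrite mulf_neq0.
Qed.

Theorem theorem1p5 (R : realType) :
  (0 < set_dist (closure (isingM_zeros R)) (nonneg_axis R))%E.
Proof.
apply: (@lt_le_trans _ _ 1%E); first exact: lte01.
apply: le_ereal_inf_tmp => _ [a clA] [_ [t t0 <-] <-].
rewrite lee_fin leNgt; apply/negP => lt1.
have {}lt1 : `|(a : R[i]) - t%:C| < 1.
  suff H (w : R[i]) : complex.Re `|w| < 1 -> `|w| < 1 by exact: H.
  by rewrite normc_def /= ltcR.
(* A zero this close to [a] is still within distance 1 of [t]. *)
have e0 : 0 < 1 - `|(a : R[i]) - t%:C| by rewrite subr_gt0.
have [z [[n zn] az]] := clA _ (nbhsx_ballx a _ e0).
move: zn; apply/negP; apply: isingM_stable.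
apply: (@stable_nbr _ _ t) => //.
rewrite -ball_normE /= in az.
rewrite (_ : _ - _ = ((a : R[i]) - t%:C) - (a - z)); last by ring.
apply: le_lt_trans (ler_normB _ _) _.
by rewrite addrC -ltrBrDr.
Qed.
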